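(* Let $\mathcal S\colon\mathtt C\to\mathtt{FVec}$ be a stem, let $\mathcal G$ be an $\mathcal S$-system on $X$ and let $c\in\mathtt C$. Using the identification $(X\otimes\mathcal S(c^* ))'\cong X'\otimes\mathcal S(c)\cong\mathrm{Lin}(X,\mathcal S(c))$, one has $$\mathcal G(c^* )^\vee=\mathrm{CP}(\mathcal G,\mathcal A_c).$$
   Context: All vector spaces are finite-dimensional and real; $\mathtt{FVec}$ is the category of these with linear maps, $\mathrm{Lin}(V,W)$ is the space of linear maps, $V'=\mathrm{Lin}(V,\mathbb R)$. For a convex cone $C\subseteq V$, $C^\vee=\{\varphi\in V'\mid\varphi(x)\ge 0\ \forall x\in C\}$. A star autonomous category is a symmetric monoidal category $(\mathtt C,\otimes,\mathbf 1)$ with a full and faithful functor ${}^*\colon\mathtt C^{\mathrm{op}}\to\mathtt C$ and a natural bijection $\mathtt C(a\otimes b,c)\cong\mathtt C(a,(b\otimes c^* )^* )$. $\mathtt{FVec}$ is star autonomous with the usual tensor product and dual. A stem is a star autonomous functor $\mathcal S\colon\mathtt C\to\mathtt{FVec}$, where $\mathtt C$ is star autonomous: i.e. a strong monoidal functor with natural isomorphisms $\mathcal S(c^* )\cong\mathcal S(c)'$, such that $\mathcal S$ carries the bijection $\mathtt C(a\otimes b,c)\cong\mathtt C(a,(b\otimes c^* )^* )$ to the corresponding bijection in $\mathtt{FVec}$. These isomorphisms are written as equalities: $\mathcal S(\mathbf 1)=\mathbb R$, $\mathcal S(\mathbf 1^* )=\mathbb R'=\mathbb R$, $\mathcal S(c\otimes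 d)=\mathcal S(c)\otimes\mathcal S(d)$, $\mathcal S(c^* )=\mathcal S(c)'$. For $c\in\mathtt C$ the intrinsic cone is $A(c)=\{v\in\mathcal S(c)\mid\mathcal S(\varphi)(v)\ge 0\ \forall\varphi\in\mathtt C(c,\mathbf 1^* )\}$. An $\mathcal S$-system $\mathcal G$ on $X$ is a family of closed convex cones $\mathcal G(c)\subseteq X\otimes\mathcal S(c)$, $c\in\mathtt C$, with $(\mathrm{id}_X\otimes\mathcal S(\Phi))(\mathcal G(c))\subseteq\mathcal G(d)$ for all $\Phi\in\mathtt C(c,d)$. For $\mathcal S$-systems $\mathcal G$ on $X$ and $\mathcal E$ on $Y$, $\mathrm{CP}(\mathcal G,\mathcal E)$ is the set of $\Psi\in\mathrm{Lin}(X,Y)$ that are completely positive, i.e. $(\Psi\otimes\mathrm{id}_{\mathcal S(c)})(\mathcal G(c))\subseteq\mathcal E(c)$ for all $c\in\mathtt C$. The intrinsic system $\mathcal A_c$ is the $\mathcal S$-system on $\mathcal S(c)$ given by $\mathcal A_c(d)=A(c\otimes d)\subseteq\mathcal S(c)\otimes\mathcal S(d)$. *)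

(* Defs.v *)
From HB Require Import structures.
From mathcomp Require Import all_boot all_order all_algebra.
From mathcomp Require Import all_classical all_reals all_analysis.
Import numFieldTopology.Exports numFieldNormedType.Exports.

Set Implicit Arguments.
Unset Strict Implicit.
Unset Printing Implicit Defensive.

Import Order.TTheory GRing.Theory Num.Theory.
Local Open Scope ring_scope.
Local Open Scope classical_set_scope.

Reserved Notation "g \c f" (at level 50, left associativity).
Reserved Notation "a \ox b" (at level 40, left associativity).
Reserved Notation "f \om g" (at level 40, left associativity).

Record category := Category {
  ob :> Type;
  mor : ob -> ob -> Type;
  mid : forall a, mor a a;
  mcomp : forall a b c, mor b c -> mor a b -> mor a c;
  mcompA : forall a b c d (h : mor c d) (g : mor b c) (f : mor a b),
    mcomp h (mcomp g f) = mcomp (mcomp h g) f;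
  mcomp1l : forall a b (f : mor a b), mcomp (mid b) f = f;
  mcomp1r : forall a b (f : mor a b), mcomp f (mid a) = f }.

Arguments mor {c0} a b : rename.
Arguments mid {c0} a : rename.
Arguments mcomp {c0 a b c} g f : rename.
Notation "g \c f" := (mcomp g f).

Record iso (C : category) (a b : C) := Iso {
  fwd :> mor a b;
  bwd : mor b a;
  fwdK : bwd \c fwd = mid a;
  bwdK : fwd \c bwd = mid b }.

Definition iso_sym (C : category) (a b : C) (f : iso a b) : iso b a :=
  Iso (bwdK f) (fwdK f).

Lemma iso_comp_subproof (C : category) (a b c : C) (g : iso b c) (f : iso a b) :
  (bwd f \c bwd g) \c (fwd g \c fwd f) = mid a.
Proof. by rewrite mcompA -(mcompA (bwd f)) fwdK mcomp1r fwdK. Qed.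

Definition iso_comp (C : category) (a b c : C) (g : iso b c) (f : iso a b) :
  iso a c :=
  Iso (iso_comp_subproof g f) (iso_comp_subproof (iso_sym f) (iso_sym g)).

Record symMonCat := SymMonCat {
  smc_cat :> category;
  tens : smc_cat -> smc_cat -> smc_cat;
  tensm : forall a a' b b' : smc_cat,
    mor a a' -> mor b b' -> mor (tens a b) (tens a' b');
  unit_ob : smc_cat;
  assoc : forall a b c, iso (tens (tens a b) c) (tens a (tens b c));
  lunit : forall a, iso (tens unit_ob a) a;
  runit : forall a, iso (tens a unit_ob) a;
  braid : forall a b, iso (tens a b) (tens b a);
  tensm1 : forall a b, tensm (mid a) (mid b) = mid (tens a b);
  tensmM : forall a a' a'' b b' b'' (f' : mor a' a'') (f : mor a a')
      (g' : mor b' b'') (g : mor b b'),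
    tensm (f' \c f) (g' \c g) = tensm f' g' \c tensm f g;
  assoc_nat : forall a a' b b' c c' (f : mor a a') (g : mor b b') (h : mor c c'),
    assoc a' b' c' \c tensm (tensm f g) h
      = tensm f (tensm g h) \c assoc a b c;
  lunit_nat : forall a a' (f : mor a a'),
    lunit a' \c tensm (mid unit_ob) f = f \c lunit a;
  runit_nat : forall a a' (f : mor a a'),
    runit a' \c tensm f (mid unit_ob) = f \c runit a;
  braid_nat : forall a a' b b' (f : mor a a') (g : mor b b'),
    braid a' b' \c tensm f g = tensm g f \c braid a b;
  pentagon : forall a b c d,
    tensm (mid a) (assoc b c d) \c assoc a (tens b c) d
        \c tensm (assoc a b c) (mid d)
      = assoc a b (tens c d) \c assoc (tens a b) c d;
  triangle : forall a b,
    tensm (mid a) (lunit b) \c assoc a unit_ob b = tensm (runit a) (mid b);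
  hexagon : forall a b c,
    assoc b c a \c braid a (tens b c) \c assoc a b c
      = tensm (mid b) (braid a c) \c assoc b a c \c tensm (braid a b) (mid c);
  braidK : forall a b, braid b a \c braid a b = mid (tens a b) }.

Arguments tens {s} a b.
Arguments tensm {s a a' b b'} f g.
Arguments unit_ob {s}.
Arguments assoc {s} a b c.
Arguments lunit {s} a.
Arguments runit {s} a.
Arguments braid {s} a b.
Notation "a \ox b" := (tens a b).
Notation "f \om g" := (tensm f g).

Record starAutCat := StarAutCat {
  sac_smc :> symMonCat;
  star : sac_smc -> sac_smc;
  starm : forall a b : sac_smc, mor a b -> mor (star b) (star a);
  tcurry : forall a b c : sac_smc,
    mor (a \ox b) c -> mor a (star (b \ox star c));
  starm1 : forall a, starm (mid a) = mid (star a);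
  starmM : forall a b c (g : mor b c) (f : mor a b),
    starm (g \c f) = starm f \c starm g;
  (* the contravariant functor star is full and faithful *)
  starm_bij : forall a b, bijective (@starm a b);
  tcurry_bij : forall a b c, bijective (@tcurry a b c);
  (* naturality in a, b and c at once *)
  tcurry_nat : forall a a' b b' c c' (f : mor a' a) (g : mor b' b) (h : mor c c')
      (phi : mor (a \ox b) c),
    tcurry (h \c phi \c (f \om g)) = starm (g \om starm h) \c tcurry phi \c f }.

Arguments star {s} a.
Arguments starm {s a b} f.
Arguments tcurry {s a b c} phi.

(* A strong monoidal functor together with natural isomorphisms F(a^* ) = F(a)^*
   carrying the adjunction bijection of C to that of D; compatibility with the
   braidings is not part of the definition. *)
Record starFunctor (C D : starAutCat) := StarFunctor {
  fob :> C -> D;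
  fhom : forall a b : C, mor a b -> mor (fob a) (fob b);
  funit : iso unit_ob (fob unit_ob);
  ftens : forall a b, iso (fob a \ox fob b) (fob (a \ox b));
  fstar : forall a, iso (fob (star a)) (star (fob a));
  fhom1 : forall a, fhom (mid a) = mid (fob a);
  fhomM : forall a b c (g : mor b c) (f : mor a b),
    fhom (g \c f) = fhom g \c fhom f;
  ftens_nat : forall a a' b b' (f : mor a a') (g : mor b b'),
    ftens a' b' \c (fhom f \om fhom g) = fhom (f \om g) \c ftens a b;
  ftens_assoc : forall a b c,
    fhom (assoc a b c) \c ftens (a \ox b) c \c (ftens a b \om mid (fob c))
      = ftens a (b \ox c) \c (mid (fob a) \om ftens b c)
        \c assoc (fob a) (fob b) (fob c);
  ftens_lunit : forall a,
    fhom (lunit a) \c ftens unit_ob a \c (funit \om mid (fob a))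
      = lunit (fob a);
  ftens_runit : forall a,
    fhom (runit a) \c ftens a unit_ob \c (mid (fob a) \om funit)
      = runit (fob a);
  fstar_nat : forall a b (f : mor a b),
    fstar a \c fhom (starm f) = starm (fhom f) \c fstar b;
  fcurry : forall a b c (phi : mor (a \ox b) c),
    starm (mid (fob b) \om bwd (fstar c)) \c starm (ftens b (star c))
        \c fstar (b \ox star c) \c fhom (tcurry phi)
      = tcurry (fhom phi \c ftens a b) }.

Arguments fhom {C D} s {a b} f.
Arguments funit {C D} s.
Arguments ftens {C D} s a b.
Arguments fstar {C D} s a.

Section Tensor.
Variable K : fieldType.
Implicit Types U V W X : vectType K.

Definition dualv V : vectType K := 'Hom(V, K^o).

(* V (x) W is modelled as Lin(V', W), the pure tensor v (x) w being the map
   phi |-> phi(v) w; see [tlift_unique] for the universal property. *)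
Definition tensorv V W : vectType K := 'Hom(dualv V, W).

Definition pure V W (v : V) (w : W) : tensorv V W :=
  linfun (fun phi : dualv V => (phi v : K) *: w).

Definition vb V (i : 'I_(\dim {:V})) : V := (vbasis {:V})`_i.
Arguments vb {V} i.
Definition vbd V (i : 'I_(\dim {:V})) : dualv V :=
  linfun (coord (vbasis {:V}) i : V -> K^o).
Arguments vbd {V} i.

Definition bilin V W U (f : V -> W -> U) : Prop :=
  (forall w, linear (f^~ w)) /\ (forall v, linear (f v)).

(* For bilinear f, the linear map v (x) w |-> f v w, cf. [tliftE]. *)
Definition tlift V W U (f : V -> W -> U) : 'Hom(tensorv V W, U) :=
  linfun (fun t : tensorv V W => \sum_i f (vb i) (t (vbd i))).

Lemma linfunE V W (f : V -> W) : linear f -> linfun f =1 f.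
Proof.
move=> lf v; pose fL : {linear V -> W} :=
  HB.pack f (GRing.isLinear.Build K V W *:%R f lf).
exact: (lfunE fL).
Qed.

Lemma vb_expand V (v : V) : v = \sum_i (vbd i v : K) *: vb i.
Proof.
rewrite {1}(coord_vbasis (memvf v)); apply: eq_bigr => i _.
by rewrite /vbd lfunE.
Qed.

Lemma vbd_expand V (phi : dualv V) : phi = \sum_i (phi (vb i) : K) *: vbd i.
Proof.
apply/lfunP => v; rewrite {1}(vb_expand v) linear_sum sum_lfunE.
by apply: eq_bigr => i _; rewrite linearZ scale_lfunE; exact: mulrC.
Qed.

Lemma pureE V W (v : V) (w : W) phi : pure v w phi = (phi v : K) *: w.
Proof.
by rewrite /pure linfunE // => a x y; rewrite add_lfunE scale_lfunE scalerDl scalerA.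
Qed.

Lemma pure_bilin V W : bilin (@pure V W).
Proof.
split=> [w|v] a x y; apply/lfunP => phi;
  rewrite add_lfunE scale_lfunE !pureE.
- by rewrite linearP scalerDl scalerA.
- by rewrite scalerDr !scalerA mulrC.
Qed.

Lemma pure_linl V W (w : W) : linear (@pure V W ^~ w).
Proof. by case: (pure_bilin V W). Qed.
Arguments pure_linl {V W} w.

Lemma pure_linr V W (v : V) : linear (@pure V W v).
Proof. by case: (pure_bilin V W). Qed.
Arguments pure_linr {V W} v.

Lemma pureZl V W a (v : V) (w : W) : pure (a *: v) w = a *: pure v w.
Proof. by apply/lfunP => phi; rewrite scale_lfunE !pureE linearZ scalerA. Qed.

Lemma pureZr V W a (v : V) (w : W) : pure v (a *: w) = a *: pure v w.
Proof. by apply/lfunP => phi; rewrite scale_lfunE !pureE !scalerA mulrC. Qed.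

Lemma pure_expand V W (t : tensorv V W) : t = \sum_i pure (vb i) (t (vbd i)).
Proof.
apply/lfunP => phi; rewrite {1}(vbd_expand phi) linear_sum sum_lfunE.
by apply: eq_bigr => i _; rewrite linearZ pureE.
Qed.

Lemma tensor_ext V W U (f g : 'Hom(tensorv V W, U)) :
  (forall v w, f (pure v w) = g (pure v w)) -> f = g.
Proof.
move=> fg; apply/lfunP => t; rewrite (pure_expand t) !linear_sum.
by apply: eq_bigr => i _; exact: fg.
Qed.

Lemma linear_suml V W (f : V -> W) : linear f ->
  forall I (r : seq I) (a : I -> K) (x : I -> V),
  f (\sum_(i <- r) a i *: x i) = \sum_(i <- r) a i *: f (x i).
Proof.
move=> lf I r a x; rewrite -(linfunE lf) linear_sum.
by apply: eq_bigr => i _; rewrite linearZ /= (linfunE lf).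
Qed.

Lemma tliftE V W U (f : V -> W -> U) : bilin f ->
  forall v w, tlift f (pure v w) = f v w.
Proof.
move=> [fl fr] v w; rewrite /tlift linfunE; last first.
  move=> a x y; rewrite scaler_sumr -big_split; apply: eq_bigr => i _ /=.
  by rewrite add_lfunE scale_lfunE fr.
rewrite {2}(vb_expand v) (linear_suml (fl w)).
apply: eq_bigr => i _; rewrite pureE.
by rewrite -!(linfunE (fr (vb i))) linearZ.
Qed.

Lemma tlift_unique V W U (f : V -> W -> U) : bilin f ->
  forall h : 'Hom(tensorv V W, U),
  (forall v w, h (pure v w) = f v w) <-> h = tlift f.
Proof.
move=> bf h; split=> [hE|->]; last exact: tliftE.
by apply: tensor_ext => v w; rewrite hE tliftE.
Qed.

Definition fvec_cat : category :=
  @Category (vectType K) (fun V W => 'Hom(V, W)) (fun V => \1%VF)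
    (fun V W U g f => (g \o f)%VF)
    (fun V W U X h g f => comp_lfunA h g f)
    (fun V W f => comp_lfun1l f) (fun V W f => comp_lfun1r f).

Definition tensorm V V' W W' (f : 'Hom(V, V')) (g : 'Hom(W, W')) :
  'Hom(tensorv V W, tensorv V' W') := tlift (fun v w => pure (f v) (g w)).

Lemma tensormE V V' W W' (f : 'Hom(V, V')) (g : 'Hom(W, W')) v w :
  tensorm f g (pure v w) = pure (f v) (g w).
Proof.
by rewrite tliftE //; split=> ? a ? ?; rewrite !linearP ?(pure_linl, pure_linr).
Qed.

Definition assoc_map V W U :
  'Hom(tensorv (tensorv V W) U, tensorv V (tensorv W U)) :=
  tlift (fun t u => tlift (fun v w => pure v (pure w u)) t).

Definition assoc_inv V W U :
  'Hom(tensorv V (tensorv W U), tensorv (tensorv V W) U) :=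
  tlift (fun v t => tlift (fun w u => pure (pure v w) u) t).

Definition lunit_map V : 'Hom(tensorv K^o V, V) :=
  tlift (fun (a : K^o) v => (a : K) *: v).
Definition lunit_inv V : 'Hom(V, tensorv K^o V) :=
  linfun (fun v => pure (1 : K^o) v).
Definition runit_map V : 'Hom(tensorv V K^o, V) :=
  tlift (fun v (a : K^o) => (a : K) *: v).
Definition runit_inv V : 'Hom(V, tensorv V K^o) :=
  linfun (fun v => pure v (1 : K^o)).

Definition braid_map V W : 'Hom(tensorv V W, tensorv W V) :=
  tlift (fun v w => pure w v).

Definition dualm V W (f : 'Hom(V, W)) : 'Hom(dualv W, dualv V) :=
  linfun (fun phi : dualv W => (phi \o f)%VF : dualv V).

Definition curry_map V W U (f : 'Hom(tensorv V W, U)) :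
  'Hom(V, dualv (tensorv W (dualv U))) :=
  linfun (fun v => tlift (fun w (psi : dualv U) => psi (f (pure v w)))).

Lemma assoc_bilin V W U (u : U) :
  bilin (fun (v : V) (w : W) => pure v (pure w u)).
Proof. by split=> [w|v] a x y; rewrite ?pure_linl ?pure_linr. Qed.
Arguments assoc_bilin {V W U} u.

Lemma assoc_mapE V W U (v : V) (w : W) (u : U) :
  assoc_map V W U (pure (pure v w) u) = pure v (pure w u).
Proof.
rewrite tliftE ?(tliftE (assoc_bilin _)) //.
split=> [{}u|t] a x y; first by rewrite linearP.
rewrite -scale_lfunE -add_lfunE; move: t; apply/lfunP/tensor_ext => {}v {}w.
by rewrite add_lfunE scale_lfunE !(tliftE (assoc_bilin _)) !pure_linr.
Qed.

Lemma assocI_bilin V W U (v : V) :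
  bilin (fun (w : W) (u : U) => pure (pure v w) u).
Proof.
by split=> [u|w] a x y; rewrite ?pure_linr // -?pure_linl ?pure_linr.
Qed.
Arguments assocI_bilin {V W U} v.

Lemma assoc_invE V W U (v : V) (w : W) (u : U) :
  assoc_inv V W U (pure v (pure w u)) = pure (pure v w) u.
Proof.
rewrite tliftE ?(tliftE (assocI_bilin _)) //.
split=> [t|{}v] a x y; last by rewrite linearP.
rewrite -scale_lfunE -add_lfunE; move: t; apply/lfunP/tensor_ext => {}w {}u.
by rewrite add_lfunE scale_lfunE !(tliftE (assocI_bilin _)) -pure_linl -pure_linl.
Qed.

Lemma lunit_mapE V (a : K^o) (v : V) : lunit_map V (pure a v) = (a : K) *: v.
Proof.
rewrite tliftE //; split=> [w|b] c x y /=; first by rewrite scalerDl scalerA.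
by rewrite scalerDr !scalerA mulrC.
Qed.

Lemma runit_mapE V (a : K^o) (v : V) : runit_map V (pure v a) = (a : K) *: v.
Proof.
rewrite tliftE //; split=> [b|w] c x y /=; last by rewrite scalerDl scalerA.
by rewrite scalerDr !scalerA mulrC.
Qed.

Lemma lunit_invE V (v : V) : lunit_inv V v = pure (1 : K^o) v.
Proof. by rewrite linfunE //; exact: pure_linr. Qed.

Lemma runit_invE V (v : V) : runit_inv V v = pure v (1 : K^o).
Proof. by rewrite linfunE //; exact: pure_linl. Qed.

Lemma braid_mapE V W (v : V) (w : W) : braid_map V W (pure v w) = pure w v.
Proof. by rewrite tliftE //; split=> [?|?]; [exact: pure_linr|exact: pure_linl]. Qed.

Lemma dualmE V W (f : 'Hom(V, W)) phi v : dualm f phi v = phi (f v).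
Proof.
rewrite linfunE ?comp_lfunE // => a x y.
by apply/lfunP => u; rewrite comp_lfunE !(add_lfunE, scale_lfunE) !comp_lfunE.
Qed.

Lemma curry_bilin V W U (f : 'Hom(tensorv V W, U)) v :
  bilin (fun w (psi : dualv U) => psi (f (pure v w))).
Proof.
split=> [psi|w] a x y; first by rewrite pure_linr !linearP.
by rewrite add_lfunE scale_lfunE.
Qed.
Arguments curry_bilin {V W U} f v.

Lemma curry_mapE V W U (f : 'Hom(tensorv V W, U)) v w psi :
  curry_map f v (pure w psi) = psi (f (pure v w)).
Proof.
rewrite linfunE ?(tliftE (curry_bilin _ _)) // => a x y.
apply: tensor_ext => {}w {}psi.
by rewrite add_lfunE scale_lfunE !(tliftE (curry_bilin _ _)) pure_linl !linearP.
Qed.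

Definition lfE := (tensormE, assoc_mapE, assoc_invE, lunit_mapE, runit_mapE,
  lunit_invE, runit_invE, braid_mapE, dualmE, curry_mapE, comp_lfunE, id_lfunE).

Lemma tensor_ext3 V W U X (f g : 'Hom(tensorv (tensorv V W) U, X)) :
  (forall v w u, f (pure (pure v w) u) = g (pure (pure v w) u)) -> f = g.
Proof.
move=> fg; apply: tensor_ext => t u.
have linu (h : 'Hom(tensorv (tensorv V W) U, X)) :
    linear (fun t : tensorv V W => h (pure t u)).
  by move=> a x y; rewrite pure_linl linearP.
rewrite -(linfunE (linu f)) -(linfunE (linu g)); move: t; apply/lfunP.
by apply: tensor_ext => v w; rewrite !linfunE.
Qed.

Lemma tensor_ext3r V W U X (f g : 'Hom(tensorv V (tensorv W U), X)) :
  (forall v w u, f (pure v (pure w u)) = g (pure v (pure w u))) -> f = g.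
Proof.
move=> fg; apply: tensor_ext => v t.
have linu (h : 'Hom(tensorv V (tensorv W U), X)) :
    linear (fun t : tensorv W U => h (pure v t)).
  by move=> a x y; rewrite pure_linr linearP.
rewrite -(linfunE (linu f)) -(linfunE (linu g)); move: t; apply/lfunP.
by apply: tensor_ext => w u; rewrite !linfunE.
Qed.

Lemma tensor_ext4 V W U Y X
    (f g : 'Hom(tensorv (tensorv (tensorv V W) U) Y, X)) :
  (forall v w u y, f (pure (pure (pure v w) u) y)
                 = g (pure (pure (pure v w) u) y)) -> f = g.
Proof.
move=> fg; apply: tensor_ext => t u.
have linu (h : 'Hom(tensorv (tensorv (tensorv V W) U) Y, X)) :
    linear (fun t : tensorv (tensorv V W) U => h (pure t u)).
  by move=> a x y; rewrite pure_linl linearP.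
rewrite -(linfunE (linu f)) -(linfunE (linu g)); move: t; apply/lfunP.
by apply: tensor_ext3 => v w y; rewrite !linfunE.
Qed.

Definition assoc_iso V W U :
  @iso fvec_cat (tensorv (tensorv V W) U) (tensorv V (tensorv W U)).
Proof.
apply: (@Iso fvec_cat _ _ (assoc_map V W U) (assoc_inv V W U)).
- by apply: tensor_ext3 => v w u; rewrite !lfE.
- by apply: tensor_ext3r => v w u; rewrite !lfE.
Defined.

Definition lunit_iso V : @iso fvec_cat (tensorv K^o V) V.
Proof.
apply: (@Iso fvec_cat _ _ (lunit_map V) (lunit_inv V)).
- apply: tensor_ext => a v; rewrite !lfE pureZr -pureZl.
  by congr pure; exact: mulr1.
- by apply/lfunP => v; rewrite !lfE scale1r.
Defined.

Definition runit_iso V : @iso fvec_cat (tensorv V K^o) V.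
Proof.
apply: (@Iso fvec_cat _ _ (runit_map V) (runit_inv V)).
- apply: tensor_ext => v a; rewrite !lfE pureZl -pureZr.
  by congr pure; exact: mulr1.
- by apply/lfunP => v; rewrite !lfE scale1r.
Defined.

Definition braid_iso V W : @iso fvec_cat (tensorv V W) (tensorv W V).
Proof.
by apply: (@Iso fvec_cat _ _ (braid_map V W) (braid_map W V));
  apply: tensor_ext => v w; rewrite !lfE.
Defined.

Definition fvec_smc : symMonCat.
Proof.
apply: (@SymMonCat fvec_cat tensorv tensorm (K^o : vectType K)
          assoc_iso lunit_iso runit_iso braid_iso).
- by move=> V W; apply: tensor_ext => v w; rewrite !lfE.
- by move=> *; apply: tensor_ext => v w; rewrite !lfE.
- by move=> *; apply: tensor_ext3 => v w u; rewrite !lfE.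
- by move=> *; apply: tensor_ext => v w; rewrite !lfE linearZ.
- by move=> *; apply: tensor_ext => v w; rewrite !lfE linearZ.
- by move=> *; apply: tensor_ext => v w; rewrite !lfE.
- by move=> *; apply: tensor_ext4 => v w u x; rewrite !lfE.
- move=> V W; apply: tensor_ext3 => v a w; rewrite !lfE.
  by rewrite pureZl pureZr.
- by move=> *; apply: tensor_ext3 => v w u; rewrite !lfE.
- by move=> *; apply: tensor_ext => v w; rewrite !lfE.
Defined.

(* Inverse of the canonical map V -> V'' *)
Definition undual V (xi : dualv (dualv V)) : V :=
  \sum_i (xi (vbd i) : K) *: vb i.

Lemma undual_lin V : linear (@undual V).
Proof.
move=> a x y; rewrite scaler_sumr -big_split; apply: eq_bigr => i _ /=.
by rewrite add_lfunE scale_lfunE scalerDl scalerA.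
Qed.

Lemma undualE V (xi : dualv (dualv V)) (phi : dualv V) : phi (undual xi) = xi phi.
Proof.
rewrite {2}(vbd_expand phi) !linear_sum; apply: eq_bigr => i _.
by rewrite !linearZ; exact: mulrC.
Qed.

Lemma dual_sep V (x y : V) : (forall phi : dualv V, phi x = phi y) -> x = y.
Proof. by move=> h; rewrite (vb_expand x) (vb_expand y); apply: eq_bigr => i _; rewrite h. Qed.

Lemma dualm_bij V W : bijective (@dualm V W).
Proof.
pose ev (G : 'Hom(dualv W, dualv V)) (v : V) : dualv (dualv W) :=
  linfun (fun phi : dualv W => G phi v : K^o).
have evE G v phi : ev G v phi = G phi v.
  by rewrite linfunE // => a x y; rewrite linearP add_lfunE scale_lfunE.
have lev G : linear (fun v => undual (ev G v)).
  move=> a x y; rewrite -undual_lin; congr undual; apply/lfunP => phi.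
  by rewrite add_lfunE scale_lfunE !evE linearP.
exists (fun G => linfun (fun v => undual (ev G v))) => [f|G].
- apply/lfunP => v; apply: dual_sep => phi.
  by rewrite linfunE // undualE evE dualmE.
- by apply/lfunP => phi; apply/lfunP => v; rewrite dualmE linfunE // undualE evE.
Qed.

Lemma curry_map_bij V W U : bijective (@curry_map V W U).
Proof.
pose ev (G : 'Hom(V, dualv (tensorv W (dualv U)))) v w : dualv (dualv U) :=
  linfun (fun psi : dualv U => G v (pure w psi) : K^o).
have evE G v w psi : ev G v w psi = G v (pure w psi).
  by rewrite linfunE // => a x y; rewrite pure_linr linearP.
have bev G : bilin (fun v w => undual (ev G v w)).
  split=> [w|v] a x y; rewrite -undual_lin; congr undual; apply/lfunP => psi;
    rewrite add_lfunE scale_lfunE !evE.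
  - by rewrite linearP add_lfunE scale_lfunE.
  - by rewrite pure_linl linearP.
exists (fun G => tlift (fun v w => undual (ev G v w))) => [f|G].
- apply: tensor_ext => v w; apply: dual_sep => psi.
  by rewrite tliftE // undualE evE curry_mapE.
- apply/lfunP => v; apply: tensor_ext => w psi.
  by rewrite curry_mapE tliftE // undualE evE.
Qed.

Definition fvec : starAutCat.
Proof.
apply: (@StarAutCat fvec_smc dualv dualm curry_map).
- by move=> V; apply/lfunP => phi; apply/lfunP => v; rewrite !lfE.
- by move=> *; apply/lfunP => phi; apply/lfunP => v; rewrite !lfE.
- exact: dualm_bij.
- exact: curry_map_bij.
- move=> *; apply/lfunP => v; apply: tensor_ext => w psi.
  by rewrite !(lfE, curry_mapE).
Defined.

Definition linv X W : vectType K := 'Hom(X, W).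

(* xi (x) w |-> (x |-> xi(x) w), see [tens_lin_mapE]. *)
Definition tens_lin_map X W : 'Hom(tensorv (dualv X) W, linv X W) :=
  tlift (fun (xi : dualv X) w => linfun (fun x => (xi x : K) *: w)).

Lemma tens_lin_mapE X W (xi : dualv X) (w : W) (x : X) :
  tens_lin_map X W (pure xi w) x = (xi x : K) *: w.
Proof.
have lin2 (zeta : dualv X) (u : W) : linear (fun x => (zeta x : K) *: u).
  by move=> a y z; rewrite linearP scalerDl scalerA.
rewrite tliftE ?linfunE //.
split=> [u|zeta] a y z; apply/lfunP => x'; rewrite add_lfunE scale_lfunE !(linfunE (lin2 _ _)).
- by rewrite add_lfunE scale_lfunE scalerDl scalerA.
- by rewrite scalerDr !scalerA mulrC.
Qed.

Definition tens_lin_inv X W : 'Hom(linv X W, tensorv (dualv X) W) :=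
  linfun (fun f : linv X W => \sum_i pure (vbd i) (f (vb i))).

Lemma tens_lin_invE X W (f : linv X W) :
  tens_lin_inv X W f = \sum_i pure (vbd i) (f (vb i)).
Proof.
rewrite linfunE // => a x y; rewrite scaler_sumr -big_split; apply: eq_bigr => i _.
by rewrite add_lfunE scale_lfunE pure_linr.
Qed.

Definition tens_lin_iso X W : @iso fvec (tensorv (dualv X) W) (linv X W).
Proof.
apply: (@Iso fvec _ _ (tens_lin_map X W) (tens_lin_inv X W)).
- apply: tensor_ext => xi w; rewrite !lfE tens_lin_invE.
  rewrite {2}(vbd_expand xi) (linear_suml (pure_linl w)).
  apply: eq_bigr => i _; by rewrite tens_lin_mapE pureZr.
- apply/lfunP => f; apply/lfunP => x; rewrite !lfE tens_lin_invE.
  rewrite linear_sum sum_lfunE {2}(vb_expand x) linear_sum.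
  by apply: eq_bigr => i _; rewrite tens_lin_mapE linearZ.
Defined.

(* xi (x) w |-> (x (x) psi |-> xi(x) psi(w)) *)
Definition tens_dual_map X W :
  'Hom(tensorv (dualv X) W, dualv (tensorv X (dualv W))) :=
  tlift (fun (xi : dualv X) w =>
    tlift (fun x (psi : dualv W) => ((xi x : K) * (psi w : K) : K^o))).

Lemma tens_dual_mapE X W (xi : dualv X) (w : W) (x : X) (psi : dualv W) :
  tens_dual_map X W (pure xi w) (pure x psi) = (xi x : K) * (psi w : K).
Proof.
have bil (zeta : dualv X) (u : W) :
    bilin (fun x (psi : dualv W) => ((zeta x : K) * (psi u : K) : K^o)).
  split=> [p|y] a y' z; first by rewrite linearP mulrDl -mulrA.
  by rewrite add_lfunE scale_lfunE mulrDr /= mulrCA.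
rewrite tliftE ?(tliftE (bil _ _)) //.
split=> [u|zeta] a y z; apply: tensor_ext => x' p;
  rewrite add_lfunE scale_lfunE !(tliftE (bil _ _)).
- by rewrite add_lfunE scale_lfunE mulrDl -mulrA.
- by rewrite linearP mulrDr /= mulrCA.
Qed.

Definition tens_slice X W (F : dualv (tensorv X (dualv W))) (x : X) :
  dualv (dualv W) := linfun (fun psi : dualv W => F (pure x psi) : K^o).

Lemma tens_sliceE X W (F : dualv (tensorv X (dualv W))) (x : X) psi :
  tens_slice F x psi = F (pure x psi).
Proof. by rewrite linfunE // => a y z; rewrite pure_linr linearP. Qed.

Definition tens_dual_inv X W :
  'Hom(dualv (tensorv X (dualv W)), tensorv (dualv X) W) :=
  linfun (fun F : dualv (tensorv X (dualv W)) =>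
    \sum_i pure (vbd i) (undual (tens_slice F (vb i)))).

Lemma tens_dual_invE X W (F : dualv (tensorv X (dualv W))) :
  tens_dual_inv X W F = \sum_i pure (vbd i) (undual (tens_slice F (vb i))).
Proof.
rewrite linfunE // => a x y; rewrite scaler_sumr -big_split; apply: eq_bigr => i _ /=.
rewrite -pure_linr -undual_lin; congr (pure _ (undual _)); apply/lfunP => psi.
by rewrite !(add_lfunE, scale_lfunE, tens_sliceE).
Qed.

Definition tens_dual_iso X W :
  @iso fvec (tensorv (dualv X) W) (dualv (tensorv X (dualv W))).
Proof.
apply: (@Iso fvec _ _ (tens_dual_map X W) (tens_dual_inv X W)).
- apply: tensor_ext => xi w; rewrite !lfE tens_dual_invE.
  rewrite {2}(vbd_expand xi) (linear_suml (pure_linl w)).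
  apply: eq_bigr => i _.
  rewrite -pureZr; congr pure; apply: dual_sep => psi.
  by rewrite undualE tens_sliceE tens_dual_mapE linearZ.
- apply/lfunP => F; apply: tensor_ext => x psi; rewrite !lfE tens_dual_invE.
  rewrite linear_sum sum_lfunE {2}(vb_expand x) (linear_suml (pure_linl psi)).
  rewrite linear_sum; apply: eq_bigr => i _.
  by rewrite tens_dual_mapE undualE tens_sliceE linearZ.
Defined.

End Tensor.

Arguments vb {K V} i.
Arguments vbd {K V} i.

Section Cones.
Variable R : realType.
Implicit Types V : vectType R.

(* The topology of a finite-dimensional space is transported from R^n along
   the coordinates of a basis; it does not depend on the basis. *)
Definition vclosed V (A : set V) : Prop :=
  closed [set r : 'rV[R]_(\dim {:V}) | A (\sum_i r 0 i *: vb i)].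

Definition convex_cone V (A : set V) : Prop :=
  [/\ A 0, (forall x y, A x -> A y -> A (x + y))
    & (forall (a : R) x, 0 <= a -> A x -> A (a *: x))].

Definition dual_cone V (A : set V) : set (dualv V) :=
  [set phi : dualv V | forall x, A x -> 0 <= (phi x : R)].

Lemma vclosed_ge0 V (J : Type) (f : J -> 'Hom(V, R^o)) :
  vclosed [set v | forall i, 0 <= (f i v : R)].
Proof.
rewrite /vclosed.
suff -> : [set r : 'rV[R]_(\dim {:V}) | [set v | forall i, 0 <= (f i v : R)]
            (\sum_i r 0 i *: vb i)]
  = \bigcap_i ((fun r : 'rV[R]_(\dim {:V}) =>
       \sum_j r 0 j * (f i (vb j) : R)) @^-1` [set x : R | 0 <= x]).
  apply: closed_bigI => i _; apply: preimage_closed; last exact: closed_ge.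
  move=> r _; move: r; apply: (@continuous_big R^o) => [|j _ r].
    exact: add_continuous.
  apply: (@cvgM R _ (nbhs r) _ (fun x : 'rV[R]_(\dim {:V}) => x 0 j)
           (fun=> f i (vb j) : R) (r 0 j) (f i (vb j) : R)).
  - exact: (@coord_continuous R _ _ 0 j r).
  - exact: cvg_cst.
have fE i (r : 'rV[R]_(\dim {:V})) : (f i (\sum_j r 0 j *: vb j) : R)
    = \sum_j r 0 j * (f i (vb j) : R).
  by rewrite linear_sum; apply: eq_bigr => j _; rewrite linearZ.
apply/seteqP; split=> r h i; first by move=> _; have := h i; rewrite fE.
by rewrite fE; exact: h.
Qed.

End Cones.

Definition stem (C : starAutCat) (R : realType) := starFunctor C (fvec R).

Section Stem.
Variables (C : starAutCat) (R : realType) (S : stem C R).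
Implicit Types c d : C.

(* [fob S] etc. with types displayed in terms of vector spaces *)
Definition sob c : vectType R := fob S c.
Definition shom c d (f : mor c d) : 'Hom(sob c, sob d) := fhom S f.
Definition stens c d : 'Hom(tensorv (sob c) (sob d), sob (c \ox d)) :=
  fwd (ftens S c d).
Definition sstar c : 'Hom(sob (star c), dualv (sob c)) := fwd (fstar S c).
Definition sunit : 'Hom(R^o, sob unit_ob) := fwd (funit S).

(* S(1^* ) = S(1)' = R' = R *)
Definition counit : 'Hom(sob (star unit_ob), R^o) :=
  linfun (fun u => sstar unit_ob u (sunit 1)).

Definition intrinsic_cone c : set (sob c) :=
  [set v | forall phi : mor c (star unit_ob), 0 <= (counit (shom phi v) : R)].
Arguments intrinsic_cone c : clear implicits.

Record ssystem (X : vectType R) := SSystem {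
  sys :> forall c, set (tensorv X (sob c));
  sys_closed : forall c, vclosed (@sys c);
  sys_cone : forall c, convex_cone (@sys c);
  sys_hom : forall c d (f : mor c d),
    tensorm \1%VF (shom f) @` @sys c `<=` @sys d }.

Arguments sys {X} s c.

Definition CP (X Y : vectType R) (G : ssystem X) (E : ssystem Y) :
  set (linv X Y) :=
  [set Psi : linv X Y |
    forall c, tensorm Psi (\1%VF : 'End(sob c)) @` G c `<=` E c].

Definition intrinsic_set c d : set (tensorv (sob c) (sob d)) :=
  stens c d @^-1` intrinsic_cone (c \ox d).
Arguments intrinsic_set c d : clear implicits.

Lemma intrinsic_closed c d : vclosed (intrinsic_set c d).
Proof.
have := @vclosed_ge0 R _ _ (fun phi : mor (c \ox d) (star unit_ob) =>
  (counit \o shom phi \o stens c d)%VF).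
congr vclosed; apply/seteqP; split=> v h phi; have := h phi; by rewrite !comp_lfunE.
Qed.

Lemma intrinsic_convex c d : convex_cone (intrinsic_set c d).
Proof.
split=> [phi|x y hx hy phi|a x a0 hx phi].
- by rewrite !linear0.
- by rewrite !linearD addr_ge0 ?hx ?hy.
- by rewrite !linearZ /= mulr_ge0 ?hx.
Qed.

Lemma intrinsic_hom c d e (f : mor d e) :
  tensorm \1%VF (shom f) @` intrinsic_set c d `<=` intrinsic_set c e.
Proof.
move=> _ [t ht <-] phi.
have E : stens c e (tensorm \1%VF (shom f) t)
       = shom (mid c \om f) (stens c d t).
  have := ftens_nat S (mid c) f; rewrite fhom1 => /lfunP/(_ t).
  by rewrite !comp_lfunE.
have := ht (phi \c (mid c \om f)).
by rewrite E /shom fhomM comp_lfunE.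
Qed.

(* the system A_c *)
Definition intrinsic_system c : ssystem (sob c) :=
  SSystem (@intrinsic_closed c) (@intrinsic_convex c) (@intrinsic_hom c).

Lemma dual_fstar_subproof (X : vectType R) c :
  (dualm (tensorm (\1%VF : 'End(X)) (sstar c))
   \o dualm (tensorm (\1%VF : 'End(X)) (bwd (fstar S c))))%VF = \1%VF
  /\ (dualm (tensorm (\1%VF : 'End(X)) (bwd (fstar S c)))
   \o dualm (tensorm (\1%VF : 'End(X)) (sstar c)))%VF = \1%VF.
Proof.
have /lfunP K1 := fwdK (fstar S c); have /lfunP K2 := bwdK (fstar S c).
split; apply/lfunP => F; apply: tensor_ext => x u; rewrite !lfE.
- by have := K1 u; rewrite !lfE => ->.
- by have := K2 u; rewrite !lfE => ->.
Qed.

(* (X (x) S(c^* ))' = (X (x) S(c)')' *)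
Definition dual_fstar_iso (X : vectType R) c :
  @iso (fvec R) (dualv (tensorv X (sob (star c))))
                (dualv (tensorv X (dualv (sob c)))) :=
  @Iso (fvec R) _ _
    (dualm (tensorm (\1%VF : 'End(X)) (bwd (fstar S c))))
    (dualm (tensorm (\1%VF : 'End(X)) (sstar c)))
    (dual_fstar_subproof X c).1 (dual_fstar_subproof X c).2.

(* (X (x) S(c^* ))' = (X (x) S(c)')' = X' (x) S(c) = Lin(X, S(c)), that is,
   F corresponds to Psi with F(x (x) chi) = chi(Psi(x)), see [dual_linE]. *)
Definition dual_lin_iso (X : vectType R) c :
  @iso (fvec R) (dualv (tensorv X (sob (star c)))) (linv X (sob c)) :=
  iso_comp (tens_lin_iso X (sob c))
    (iso_comp (iso_sym (tens_dual_iso X (sob c))) (dual_fstar_iso X c)).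

Definition dual_lin (X : vectType R) c :
  'Hom(dualv (tensorv X (sob (star c))), linv X (sob c)) :=
  fwd (dual_lin_iso X c).

Lemma dual_linE (X : vectType R) c (F : dualv (tensorv X (sob (star c)))) x chi :
  F (pure x chi) = sstar c chi (dual_lin X c F x).
Proof.
pose T := tens_dual_inv X (sob c) (fwd (dual_fstar_iso X c) F).
have TF : dual_lin X c F = tens_lin_map X (sob c) T.
  by rewrite /dual_lin /= !comp_lfunE.
rewrite TF; have -> : F = dualm (tensorm \1%VF (sstar c)) (tens_dual_map X (sob c) T).
  have /lfunP/(_ (fwd (dual_fstar_iso X c) F)) := bwdK (tens_dual_iso X (sob c)).
  rewrite !lfE => ->.
  by have /lfunP/(_ F) := fwdK (dual_fstar_iso X c); rewrite !lfE.
rewrite !lfE; move: (sstar c chi) => psi.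
rewrite (pure_expand T) !linear_sum !sum_lfunE linear_sum.
by apply: eq_bigr => i _; rewrite tens_dual_mapE tens_lin_mapE linearZ.
Qed.

End Stem.

(* Main.v *)
Require Import Defs.
From mathcomp Require Import all_boot all_order all_algebra.
From mathcomp Require Import all_classical all_reals all_analysis.
Local Open Scope classical_set_scope.

Import GRing.Theory.
Local Open Scope ring_scope.

(** Writing [<chi, v>] for [sstar S c chi v], the pairing of [S(c^* )] with
    [S(c)], an operator [Psi] and a functional [F] correspond to each other
    when [F (x (x) chi) = <chi, Psi x>]. The proposition holds because
    morphisms [phi : c (x) d -> 1^*], which define the intrinsic cone of
    [c (x) d], correspond to morphisms [f : d -> c^*], under which the cones of
    the system are stable. On the side of vector spaces [phi] and [f] are
    transposes of each other,
      [<S(f) w, v> = S(phi) (v (x) w)],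
    so that [phi] applied to [(Psi (x) id) t] is [F] applied to
    [(id (x) S(f)) t].

    If [F] is nonnegative on [G(c^* )], then every [phi] is nonnegative on the
    image of [G(d)] under [Psi (x) id], because [(id (x) S(f)) t] lies in
    [G(c^* )]; this needs a transpose [f] for every [phi] ([transpose_ex]).
    Conversely, if [Psi] is completely positive, take [d = c^*]; this needs
    only the [phi] whose transpose is the identity of [c^*]
    ([evaluation_ex]).

    Since the functor need not respect the braiding, the transposes are built
    without it. Currying [phi] gives a morphism [c -> (d (x) 1^** )^*], and the
    comparison [bidual : a -> a^**], obtained by currying the right unit,
    serves to replace [1^**] by [1] and then to turn [c -> d^*] into
    [d -> c^*]. Compatibility of the stem with currying and units shows that
    [bidual] becomes the canonical embedding of a vector space in its double
    dual ([bidualE]). *)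

Section Transpose.
Context {R : realType} {C : starAutCat} (S : stem C R).
Implicit Types a b c d : C.

Lemma shom_comp {a b c} (g : mor b c) (f : mor a b) v :
  shom S (g \c f) v = shom S g (shom S f v).
Proof. by rewrite /shom fhomM comp_lfunE. Qed.

Lemma shom_tensm {a a' b b'} (f : mor a a') (g : mor b b') v w :
  shom S (f \om g) (stens S a b (pure v w))
  = stens S a' b' (pure (shom S f v) (shom S g w)).
Proof.
have /lfunP/(_ (pure v w)) := ftens_nat S f g.
by rewrite !lfE => ->.
Qed.

Lemma shom_mid {a} v : shom S (mid a) v = v.
Proof. by rewrite /shom fhom1 id_lfunE. Qed.

Lemma shom_isoK {a b} (f : iso a b) v : shom S (bwd f) (shom S f v) = v.
Proof. by rewrite -shom_comp fwdK shom_mid. Qed.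

Lemma shom_runit {a} v : shom S (runit a) (stens S a unit_ob (pure v (sunit S 1))) = v.
Proof.
have /lfunP/(_ (pure v (1 : R^o))) := ftens_runit S a.
by rewrite !lfE scale1r.
Qed.

Lemma shom_lunit {a} v : shom S (lunit a) (stens S unit_ob a (pure (sunit S 1) v)) = v.
Proof.
have /lfunP/(_ (pure (1 : R^o) v)) := ftens_lunit S a.
by rewrite !lfE scale1r.
Qed.

Lemma sstarK {a} chi : bwd (fstar S a) (sstar S a chi) = chi.
Proof. by have /lfunP/(_ chi) := fwdK (fstar S a); rewrite !lfE. Qed.

Lemma sstarVK {a} psi : sstar S a (bwd (fstar S a) psi) = psi.
Proof. by have /lfunP/(_ psi) := bwdK (fstar S a); rewrite !lfE. Qed.

Lemma sstar_starm {a b} (f : mor a b) chi v :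
  sstar S a (shom S (starm f) chi) v = sstar S b chi (shom S f v).
Proof.
by have /lfunP/(_ chi)/lfunP/(_ v) := fstar_nat S f; rewrite !lfE.
Qed.

(** Since [S(a)'] is only isomorphic to [S(a^* )], compatibility with currying
    is usable on elements once both duals are read through [sstar]; every
    transpose below is computed from this formula. *)
Lemma sstar_tcurry {a b c} (phi : mor (a \ox b) c) v w chi :
  sstar S (b \ox star c) (shom S (tcurry phi) v) (stens S b (star c) (pure w chi))
  = sstar S c chi (shom S phi (stens S a b (pure v w))).
Proof.
have /lfunP/(_ v)/lfunP/(_ (pure w (sstar S c chi))) := fcurry S phi.
by rewrite !lfE sstarK.
Qed.

Lemma counitE chi : counit S chi = sstar S unit_ob chi (sunit S 1).
Proof.
by rewrite /counit linfunE // => k x y; rewrite linearP add_lfunE scale_lfunE.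
Qed.

(** Currying [a \ox 1 -> a] gives [a -> (1 \ox a^* )^*], and the left unit
    identifies the target with [a^**]. *)
Definition bidual a : mor a (star (star a)) :=
  starm (bwd (lunit (star a))) \c tcurry (runit a).

Lemma bidualE a v chi :
  sstar S (star a) (shom S (bidual a) v) chi = sstar S a chi v.
Proof.
by rewrite shom_comp sstar_starm -{1}(shom_lunit chi) shom_isoK sstar_tcurry
  shom_runit.
Qed.

(** Fullness of the star functor provides the inverse: [e] is the morphism
    whose dual is [bidual (star a)], and on double duals the dual of the
    canonical embedding of [V] undoes the canonical embedding of [V']. *)
Lemma bidual_inv_ex a : exists e : mor (star (star a)) a,
  forall z chi, sstar S a chi (shom S e z) = sstar S (star a) z chi.
Proof.
have [starmI _ starmK] := @starm_bij C (star (star a)) a.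
exists (starmI (bidual (star a))) => z chi.
by rewrite -sstar_starm starmK bidualE.
Qed.

(** Currying and the replacement of [1^**] by [1] give [h : c -> d^*] with
    [<S(h) v, w> = S(phi) (v (x) w)]; the transpose is then
    [d -> d^** -> c^*], the second map being the dual of [h]. *)
Lemma transpose_ex c d (phi : mor (c \ox d) (star unit_ob)) :
  exists f : mor d (star c), forall v w,
    sstar S c (shom S f w) v = counit S (shom S phi (stens S c d (pure v w))).
Proof.
pose u : mor d (d \ox star (star unit_ob)) :=
  (mid d \om bidual unit_ob) \c bwd (runit d).
exists (starm (starm u \c tcurry phi) \c bidual d) => v w.
rewrite shom_comp sstar_starm bidualE shom_comp sstar_starm.
rewrite shom_comp -{1}(shom_runit w) shom_isoK shom_tensm shom_mid sstar_tcurry.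
by rewrite bidualE counitE.
Qed.

(** The evaluation pairing of [c] with its dual is the uncurried form of
    [bidual c], once [1] is replaced by [1^**] in the target. *)
Lemma evaluation_ex c : exists phi : mor (c \ox star c) (star unit_ob),
  forall v chi,
    counit S (shom S phi (stens S c (star c) (pure v chi))) = sstar S c chi v.
Proof.
have [e eE] := bidual_inv_ex unit_ob.
have [tcurryI _ tcurryK] := @tcurry_bij C c (star c) (star unit_ob).
exists (tcurryI (starm (runit (star c) \c (mid (star c) \om e)) \c bidual c)).
move=> v chi; set phi := tcurryI _.
(* [z] is the functional [counit] seen in [S(1^** )]; the comparison
   of [1^**] with [1] sends it to the unit because [counit] itself is
   evaluation at the unit. *)
pose z := bwd (fstar S (star unit_ob)) (counit S).
have ez : shom S e z = sunit S 1.
  apply: dual_sep => psi; rewrite -(sstarVK psi) eE [sstar S _ z]sstarVK.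
  exact: counitE.
rewrite -[counit S]sstarVK -/z -sstar_tcurry tcurryK shom_comp sstar_starm.
by rewrite shom_comp shom_tensm shom_mid ez shom_runit bidualE.
Qed.

Lemma transpose_tensor {X : vectType R} {c d} {Psi : linv X (sob S c)}
    {F : dualv (tensorv X (sob S (star c)))}
    {phi : mor (c \ox d) (star unit_ob)} {f : mor d (star c)} :
  (forall x chi, F (pure x chi) = sstar S c chi (Psi x)) ->
  (forall v w,
    sstar S c (shom S f w) v = counit S (shom S phi (stens S c d (pure v w)))) ->
  forall t,
    counit S (shom S phi (stens S c d (tensorm Psi \1%VF t)))
    = F (tensorm \1%VF (shom S f) t).
Proof.
move=> FPsi phif t.
have /lfunP/(_ t) :
    (counit S \o shom S phi \o stens S c d \o tensorm Psi \1)%VF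
    = (F \o tensorm \1 (shom S f))%VF.
  by apply: tensor_ext => x w; rewrite !lfE FPsi phif.
by rewrite !comp_lfunE.
Qed.

End Transpose.

Theorem proposition3p15 (R : realType) (C : starAutCat) (S : stem C R)
    (X : vectType R) (G : ssystem S X) (c : C) :
  dual_lin S X c @` dual_cone (G (star c)) = CP G (intrinsic_system S c).
Proof.
apply/seteqP; split=> [_ [F F_ge0 <-] d _ [t Gt <-] phi|Psi cpPsi].
  have [f phif] := transpose_ex S c d phi.
  rewrite (transpose_tensor S (dual_linE F) phif).
  by apply: F_ge0; apply: (@sys_hom _ _ _ _ G _ _ f); exists t.
pose F : dualv (tensorv X (sob S (star c))) := bwd (dual_lin_iso S X c) Psi.
have FPsi : dual_lin S X c F = Psi.
  by have /lfunP/(_ Psi) := bwdK (dual_lin_iso S X c); rewrite comp_lfunE id_lfunE.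
exists F => // t Gt.
have FE x chi : F (pure x chi) = sstar S c chi (Psi x) by rewrite dual_linE FPsi.
have [phi phiE] := evaluation_ex S c.
have phi_mid v chi : sstar S c (shom S (mid (star c)) chi) v
    = counit S (shom S phi (stens S c (star c) (pure v chi))).
  by rewrite shom_mid phiE.
have tensorm11 : tensorm \1 \1 t = t.
  have /lfunP/(_ t) := @tensm1 (fvec R) X (S (star c)).
  by rewrite id_lfunE.
(* The evaluation has the identity as its transpose, so the positivity of
   [Psi] tested on it is the positivity of [F]. *)
have := transpose_tensor S FE phi_mid t; rewrite /shom fhom1 tensorm11 => <-.
by apply: (cpPsi (star c)); exists t.
Qed.
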